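(* Let $f,g$ be non-negative integers. Then in $M^{(f,g)}$, \[\sum_{\mu\in\mathcal P_{f,g}}t_\mu m=\sum_{\lambda\in\mathcal P_{f,g}}F(\lambda)\,s_\lambda m.\]
   Context: $\mathbb F$ is any field, $k=f+g$, $\mathfrak S_k$ has Coxeter generators $t_i=(i\ i{+}1)$ and $s_i=t_i-1\in\mathbb F\mathfrak S_k$. $M^{(f,g)}=\langle m\mid t_im=m\ (i\ne f)\rangle$ as an $\mathbb F\mathfrak S_k$-module. $\mathcal P_{f,g}$ is the set of partitions with at most $g$ nonzero parts, all at most $f$. For $\lambda\in\mathcal P_{f,g}$, $t_\lambda=\prod_{r=1}^{g}(t_{\lambda_r+g-r+1}t_{\lambda_r+g-r+2}\cdots t_{f+g-r})$ with $r=1$ leftmost (a factor is empty if $\lambda_r=f$), and $s_\lambda$ is the same formula with $t_i$ replaced by $s_i$. The function $F$ on partitions is defined recursively: $F(\varnothing)=1$; for $\lambda\ne\varnothing$ choose a node $(a,b)$ of $\lambda$ (i.e. $b\le\lambda_a$) with $a+b$ maximal, and set $F(\lambda)=\binom{a+b}{a}F((\lambda_{a+1},\lambda_{a+2},\dots))\,F((\max\{\lambda_1-b,0\},\max\{\lambda_2-b,0\},\dots))$; this does not depend on the choice of $(a,b)$. The integer $F(\lambda)$ is regarded as an element of $\mathbb F$. *)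

(* Defs.v *)
From mathcomp Require Import all_boot all_order all_algebra all_fingroup.
Set Implicit Arguments. Unset Strict Implicit. Unset Printing Implicit Defensive.
Import GRing.Theory.
Local Open Scope ring_scope.

Definition GA (F : fieldType) (k : nat) := {ffun 'S_k -> F}.

Definition gdelta (F : fieldType) (k : nat) (s : 'S_k) : GA F k :=
  [ffun q => ((q == s) : nat)%:R].

Definition gamul (F : fieldType) (k : nat) (x y : GA F k) : GA F k :=
  [ffun s => \sum_(p : 'S_k) x p * y ((p^-1 * s)%g)].

Definition gascale (F : fieldType) (k : nat) (c : F) (x : GA F k) : GA F k :=
  [ffun s => c * x s].

(* Coxeter generator t_i = (i i+1), 1 <= i < k, in 1-indexed notation;
   on 'I_k (0-indexed) it swaps i-1 and i.  (Default 1 out of range, never used.) *)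
Definition tgen (k i : nat) : 'S_k :=
  match k return 'S_k with
  | 0 => 1%g
  | k'.+1 => if (0 < i < k'.+1)%N then tperm (inord i.-1 : 'I_k'.+1) (inord i) else 1%g
  end.

Definition sgen (F : fieldType) (k i : nat) : GA F k :=
  gdelta F (tgen k i) - gdelta F 1%g.

(* The sequence of indices of the factors of t_lambda (resp. s_lambda):
   for r = 1..g (leftmost first), the indices lambda_r+g-r+1, ..., f+g-r. *)
Definition lam_index (f g : nat) (lam : seq nat) : seq nat :=
  flatten [seq iota (nth 0 lam r.-1 + (g - r) + 1) (f - nth 0 lam r.-1) | r <- iota 1 g].

Definition t_lam (f g : nat) (lam : seq nat) : 'S_(f + g) :=
  foldr (fun j acc => tgen (f + g) j * acc)%g 1%g (lam_index f g lam).

Definition s_lam (F : fieldType) (f g : nat) (lam : seq nat) : GA F (f + g) :=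
  foldr (fun j acc => gamul (sgen F (f + g) j) acc) (gdelta F 1%g) (lam_index f g lam).

(* Elements of P_{f,g}: partitions with at most g parts, all at most f,
   encoded as g-tuples of values in {0..f} which are weakly decreasing
   (trailing zeros pad the partition). *)
Definition is_part (f g : nat) (t : g.-tuple 'I_f.+1) : bool :=
  sorted (fun a b => b <= a)%N (map val t).

(* The function F on partitions (lam a list of parts, possibly with zeros).
   The node (a,b) with a+b maximal lies at the end of some row a, b = lam_a;
   we take the first such row (the value is independent of the choice). *)
Definition node_max (lam : seq nat) : nat :=
  foldr maxn 0%N [seq (if (0 < nth 0 lam i)%N then i.+1 + nth 0 lam i else 0)%N
                 | i <- iota 0 (size lam)].

Definition node_row (lam : seq nat) : nat :=
  find id [seq ((0 < nth 0 lam i)%N && (i.+1 + nth 0 lam i == node_max lam)%N)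
          | i <- iota 0 (size lam)].

Fixpoint Ffuel (n : nat) (lam : seq nat) : nat :=
  match n with
  | 0 => 1
  | n'.+1 =>
    if sumn lam == 0%N then 1%N else
    let a := (node_row lam).+1 in
    let b := nth 0 lam (node_row lam) in
    ('C(a + b, a) * Ffuel n' (drop a lam) * Ffuel n' (map (fun x => x - b) lam))%N
  end.

Definition Fpart (lam : seq nat) : nat := Ffuel (sumn lam).+1 lam.

(* Main.v *)
(* M^(f,g) is the space of words in f zeros and g ones, on which S_k permutes
   positions, with m = 0^f 1^g; the left-hand side is the sum of all words.
   Matching 1 and 0 in a word w as brackets, s_lambda m is the vector C_w obtained
   from w by replacing every matched pair 10 with the antisymmetric 10 - 01.
   Such pairs are killed by the lowering operator E of sl_2, which gives
   E C_w = sum (1 + h z) C_(x0z) over w = x1z with z nonnegative (h = number of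
   1's minus number of 0's).  On the other side, F(1w) = F(w) = F(w0), and
   F(uv) = binom * F(u) F(v) whenever uv is cut at a point of minimal height;
   these imply n_0(w) F(w) = sum (1 + h z) F(x1z) over w = x0z with z nonnegative.
   Hence X = sum F(w) C_w satisfies E X = n_0 X, as does the sum of all words, and
   the two agree by induction on the number of zeros. *)
Require Import Defs.
From mathcomp Require Import all_boot all_order all_algebra all_fingroup.
From mathcomp Require Import zify ring.
Set Implicit Arguments. Unset Strict Implicit. Unset Printing Implicit Defensive.
Import GRing.Theory Num.Theory.
Local Open Scope nat_scope.

(** * The recursion for [Fpart]: the chosen node, fuel, and padding by zeros *)

Definition node_spec (lam : seq nat) (r : nat) : Prop :=
  [/\ r < size lam, 0 < nth 0 lam r,
      forall i, 0 < nth 0 lam i -> i.+1 + nth 0 lam i <= r.+1 + nth 0 lam r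
    & forall i, i < r -> 0 < nth 0 lam i ->
        i.+1 + nth 0 lam i < r.+1 + nth 0 lam r].

(** Uniqueness lets [node_row] of a padded list be recognised from its properties, without unfolding
    [find]. *)
Lemma node_spec_uniq lam r r' : node_spec lam r -> node_spec lam r' -> r = r'.
Proof.
move=> [_ p m l] [_ p' m' l']; have := m _ p'; have := m' _ p.
by case: (ltngtP r r') => // h; [have := l' _ h p | have := l _ h p']; lia.
Qed.

Lemma leq_foldr_maxn s x : x \in s -> x <= foldr maxn 0 s.
Proof.
elim: s => //= y s IH; rewrite in_cons leq_max => /orP[/eqP->|/IH->].
  by rewrite leqnn.
by rewrite orbT.
Qed.

Lemma foldr_maxn_mem s : foldr maxn 0 s = 0 \/ foldr maxn 0 s \in s.
Proof.
elim: s => [|y s IH] /=; first by left.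
rewrite in_cons /maxn; case: ltnP => _; last by right; rewrite eqxx.
by case: IH => [->|->]; [left | right; rewrite orbT].
Qed.

Lemma node_rowP lam : sumn lam != 0 -> node_spec lam (node_row lam).
Proof.
move=> nz.
have lt_size i : 0 < nth 0 lam i -> i < size lam.
  by case: (ltnP i (size lam)) => // h; rewrite nth_default.
have maxP i : 0 < nth 0 lam i -> i.+1 + nth 0 lam i <= node_max lam.
  move=> h; apply: leq_foldr_maxn; apply/mapP; exists i; last by rewrite h.
  by rewrite mem_iota /= add0n lt_size.
have [i0 p0] : exists i, 0 < nth 0 lam i.
  elim: lam nz {lt_size maxP} => //= x s IH; case: x => [|x] h; last by exists 0.
  by have [i] := IH h; exists i.+1.
pose P := [seq (0 < nth 0 lam i) && (i.+1 + nth 0 lam i == node_max lam)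
          | i <- iota 0 (size lam)].
have nthP i : i < size lam -> nth false P i =
    (0 < nth 0 lam i) && (i.+1 + nth 0 lam i == node_max lam).
  by move=> h; rewrite (nth_map 0) ?size_iota // nth_iota.
have sP : size P = size lam by rewrite size_map size_iota.
have hasP' : has id P.
  case: (foldr_maxn_mem
    [seq (if (0 < nth 0 lam i) then i.+1 + nth 0 lam i else 0)
      | i <- iota 0 (size lam)]) => [E0 | /mapP[i]].
    by have := maxP _ p0; rewrite /node_max E0.
  rewrite mem_iota add0n /= => ilt; case: ifP => [pi E | _ E]; last first.
    by have := maxP _ p0; rewrite /node_max E.
  apply/(has_nthP false); exists i; rewrite ?sP // nthP // pi.
  by rewrite /node_max E /= eqxx.
have rlt : node_row lam < size lam by rewrite /node_row -/P -sP -has_find.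
have := nth_find false hasP'; rewrite -/(node_row lam) nthP //.
case/andP=> pr /eqP mr; split=> // [i /maxP | i ilt pi]; first by rewrite -mr.
have := before_find false ilt; rewrite nthP ?(ltn_trans ilt) // pi /= => /negbT ne.
by rewrite ltn_neqAle mr ne maxP.
Qed.

Lemma node_row_nseq0 lam m : sumn lam != 0 -> node_row (lam ++ nseq m 0) = node_row lam.
Proof.
move=> nz; have [rlt pr mr lr] := node_rowP nz.
have nthE i : nth 0 (lam ++ nseq m 0) i = nth 0 lam i.
  by rewrite nth_cat; case: ltnP => // h; rewrite nth_nseq if_same nth_default.
apply: (@node_spec_uniq (lam ++ nseq m 0)).
  by apply: node_rowP; rewrite sumn_cat sumn_nseq addn0.
split=> [||i|i]; rewrite ?[nth 0 (lam ++ _) _]nthE.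
- by rewrite size_cat ltn_addr.
- by [].
- exact: mr.
exact: lr.
Qed.

Lemma Ffuel_nseq0 n lam m : Ffuel n (lam ++ nseq m 0) = Ffuel n lam.
Proof.
elim: n lam m => //= n IH lam m; rewrite sumn_cat sumn_nseq addn0.
case: eqP => // /eqP nz; rewrite node_row_nseq0 //; have [rlt pr _ _] := node_rowP nz.
rewrite nth_cat rlt map_cat map_nseq sub0n IH; congr (_ * _ * _).
by rewrite -(IH (drop _ lam) m) drop_cat; case: ltnP => // h;
   rewrite (_ : _.+1 = size lam) ?drop_size ?subnn ?drop0 //; apply/eqP; rewrite eqn_leq rlt.
Qed.

Lemma sumn_subl b lam : sumn (map (fun x => x - b) lam) <= sumn lam.
Proof. by elim: lam => //= x s IH; rewrite leq_add ?leq_subr. Qed.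

Lemma sumn_drop_lt r lam : r < size lam -> 0 < nth 0 lam r ->
  sumn (drop r.+1 lam) < sumn lam.
Proof.
move=> rlt pr; rewrite -{2}(cat_take_drop r lam) (drop_nth 0 rlt) sumn_cat /=; lia.
Qed.

Lemma sumn_sub_lt r lam : r < size lam -> 0 < nth 0 lam r ->
  sumn (map (fun x => x - nth 0 lam r) lam) < sumn lam.
Proof.
move=> rlt pr; have E : lam = take r lam ++ nth 0 lam r :: drop r.+1 lam.
  by rewrite -drop_nth ?cat_take_drop.
move: (nth 0 lam r) pr E => b pb ->; rewrite map_cat !sumn_cat /= subnn add0n.
have := sumn_subl b (take r lam); have := sumn_subl b (drop r.+1 lam); lia.
Qed.

(** Both recursive calls strictly decrease [sumn], so fuel exceeding [sumn lam] never runs out. *)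
Lemma Ffuel_enough n m lam : sumn lam < n -> sumn lam < m -> Ffuel n lam = Ffuel m lam.
Proof.
elim: n m lam => // n IH [//|m] lam ln lm /=; case: eqP => // /eqP nz.
have [rlt pr _ _] := node_rowP nz.
have d1 := sumn_drop_lt rlt pr; have d2 := sumn_sub_lt rlt pr.
(* In Ffuel the default entry of nth is the ring zero of nat. *)
have z0 : @GRing.zero nat = 0 by [].
by rewrite z0; congr (_ * _ * _); apply: IH; lia.
Qed.

Lemma Fpart_nseq0 lam m : Fpart (lam ++ nseq m 0) = Fpart lam.
Proof. by rewrite /Fpart Ffuel_nseq0 sumn_cat sumn_nseq addn0. Qed.

Lemma FpartE lam : sumn lam != 0 ->
  let a := (node_row lam).+1 in let b := nth 0 lam (node_row lam) in
  Fpart lam = 'C(a + b, a) * Fpart (drop a lam) * Fpart (map (fun x => x - b) lam).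
Proof.
move=> nz; have [rlt pr _ _] := node_rowP nz.
have d1 := sumn_drop_lt rlt pr; have d2 := sumn_sub_lt rlt pr.
rewrite {1}/Fpart /= (negPf nz).
by congr (_ * _ * _); apply: Ffuel_enough; rewrite ?ltnS.
Qed.

(** * Height conditions on words in 0 and 1 *)

Notation c0 := (count negb).
Notation c1 := (count id).

Definition nonneg (z : seq bool) : bool :=
  all (fun i => c0 (take i z) <= c1 (take i z)) (iota 0 (size z).+1).

(** With height meaning 1's minus 0's, [u] ends at its lowest point; if moreover [nonneg v], the
    junction of [u ++ v] is a lowest point of the whole word. *)
Definition endmin (u : seq bool) : Prop := forall p q, u = p ++ q -> c1 q <= c0 q.

Lemma nonnegP z : reflect (forall p q, z = p ++ q -> c0 p <= c1 p) (nonneg z).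
Proof.
apply: (iffP allP) => [h p q E | h i _].
  have := h (size p); rewrite E take_size_cat //; apply.
  by rewrite mem_iota size_cat; lia.
by apply: (h _ (drop i z)); rewrite cat_take_drop.
Qed.

Lemma cat_eq_cat (T : Type) (t s u v : seq T) : t ++ s = u ++ v ->
  (exists q, u = t ++ q /\ s = q ++ v) \/ (exists q, t = u ++ q /\ v = q ++ s).
Proof.
elim: t u => [|x t IH] [|y u] /= E.
- by left; exists [::].
- by left; exists (y :: u).
- by right; exists (x :: t).
by case: E => -> /IH[[q [-> ->]]|[q [-> ->]]]; [left|right]; exists q.
Qed.

Lemma nonneg_cat u v : nonneg u -> nonneg v -> nonneg (u ++ v).
Proof.
move=> /nonnegP hu /nonnegP hv; apply/nonnegP=> p q /esym/cat_eq_cat[].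
  by move=> [t [E _]]; apply: hu E.
by move=> [t [-> E]]; have := hv _ _ E; have := hu u [::]; rewrite cats0 !count_cat => /(_ erefl); lia.
Qed.

Lemma nonneg_cons1 z : nonneg z -> nonneg (true :: z).
Proof. by move=> h; rewrite -cat1s; apply: nonneg_cat. Qed.

Lemma nonneg_cons0 z : nonneg (false :: z) = false.
Proof. by apply/negP => /nonnegP/(_ [:: false] z erefl). Qed.

Lemma nonneg_flip p q : nonneg (p ++ false :: q) -> nonneg (p ++ true :: q).
Proof.
move=> /nonnegP h; apply/nonnegP=> s t /esym/cat_eq_cat[[r [E _]]|[r [E]]].
  by apply: (h s (r ++ false :: q)); rewrite E -catA.
case: r E => [|b r] -> /=; first by have := h p _ erefl; rewrite cats0.
by case=> <- E; have := h (p ++ false :: r) t; rewrite E -catA /= => /(_ erefl); rewrite !count_cat /=; lia.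
Qed.

Lemma nonneg_insert p q : nonneg (p ++ true :: false :: q) = nonneg (p ++ q).
Proof.
apply/nonnegP/nonnegP => h s t /esym/cat_eq_cat[[r [E1 E2]]|[r [E1 E2]]].
- by apply: (h s (r ++ true :: false :: q)); rewrite E1 -catA.
- have := h (p ++ true :: false :: r) t; rewrite E2 -catA => /(_ erefl).
  by rewrite E1 !count_cat /=; lia.
- by apply: (h s (r ++ q)); rewrite E1 -catA.
case: r E1 E2 => [|b [|b' r]] -> /=.
- by move=> _; have := h p q erefl; rewrite cats0.
- by case=> <- _; have := h p q erefl; rewrite !count_cat /=; lia.
by case=> <- <- E; have := h (p ++ r) t; rewrite E -catA => /(_ erefl); rewrite !count_cat /=; lia.
Qed.

(** * Partitions read from words, and the product formula for [Fw] *)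

(* A word is read as the boundary of a partition from its bottom left corner:
   false is a step to the right and true a step up, so that the i-th 1 from the
   right is row i and its length is the number of 0's before it. *)
Fixpoint wpart (w : seq bool) : seq nat :=
  match w with
  | [::] => [::]
  | true :: w' => rcons (wpart w') 0
  | false :: w' => map succn (wpart w')
  end.

Lemma size_wpart w : size (wpart w) = c1 w.
Proof. by elim: w => //= -[] w IH; rewrite ?size_rcons ?size_map IH. Qed.

Lemma wpart_cat u v : wpart (u ++ v) = map (addn (c0 u)) (wpart v) ++ wpart u.
Proof.
elim: u => [|[] u IH] /=; first by rewrite cats0 map_id.
  by rewrite IH -rcons_cat.
by rewrite IH map_cat -map_comp.
Qed.

Lemma wpart_le w : all (fun x => x <= c0 w) (wpart w).
Proof.
elim: w => //= -[] w IH /=; first by rewrite all_rcons.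
by rewrite all_map.
Qed.

Lemma nth_wpart w i : i < c1 w -> exists t s,
  [/\ w = t ++ true :: s, c1 s = i & nth 0 (wpart w) i = c0 t].
Proof.
elim: w i => //= -[] w IH i /=.
  rewrite add1n ltnS leq_eqVlt nth_rcons size_wpart => /orP[/eqP->|h].
    by exists [::], w; rewrite ltnn eqxx.
  by rewrite h; have [t [s [-> <- ->]]] := IH i h; exists (true :: t), s.
rewrite add0n => h; have [t [s [E Es Et]]] := IH i h; exists (false :: t), s.
by rewrite (nth_map 0) ?size_wpart // Et E.
Qed.

Definition Fw (w : seq bool) : nat := Fpart (wpart w).

Lemma Fw_cons1 w : Fw (true :: w) = Fw w.
Proof. by rewrite /Fw /= -cats1 (Fpart_nseq0 _ 1). Qed.

Lemma Fw_rcons0 w : Fw (rcons w false) = Fw w.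
Proof. by rewrite /Fw -cats1 wpart_cat. Qed.

Lemma Fw_nseq1 n : Fw (nseq n true) = 1.
Proof. by elim: n => [|n IH] //; rewrite -[nseq _ _]/(true :: _) Fw_cons1. Qed.

(** Both sides are the multinomial coefficient (n+m+p)! / (n! m! p!). *)
Lemma multinomial_assoc n m p :
  'C(n + m + p, p) * 'C(n + m, m) = 'C(n + m + p, m + p) * 'C(m + p, p).
Proof.
have f a b := @bin_fact (a + b) b (leq_addl a b).
have := f (n + m) p; have := f n m; have := f n (m + p); have := f m p.
rewrite !addnK addnA => e1 e2 e3 e4.
have P := (fact_gt0 n, fact_gt0 m, fact_gt0 p).
apply/eqP; rewrite -(@eqn_pmul2r (n`! * m`! * p`!)) ?muln_gt0 ?P //; apply/eqP.
transitivity ((n + m + p)`!).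
  by rewrite -e4 -e3; ring.
by rewrite -e2 -e1; ring.
Qed.

Lemma endmin_nil : endmin [::].
Proof. by move=> [] // []. Qed.

(** The recursion at the row of the displayed 1, which has length [c0 u]: the rows below it are
    those of [u], and subtracting [c0 u] leaves the rows of [true :: v], while those of [u] become
    zeros. *)
Lemma Fpart_split u v : c0 u > 0 -> node_row (wpart (u ++ true :: v)) = c1 v ->
  Fw (u ++ true :: v) = 'C(c0 u + (c1 v).+1, (c1 v).+1) * Fw u * Fw (true :: v).
Proof.
move=> pu E.
have nthE : nth 0 (wpart (u ++ true :: v)) (c1 v) = c0 u.
  rewrite wpart_cat nth_cat size_map size_wpart /= add1n ltnSn.
  by rewrite (nth_map 0) ?size_rcons ?size_wpart // nth_rcons size_wpart ltnn eqxx addn0.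
rewrite /Fw FpartE; last first.
  apply/negP=> /eqP; rewrite wpart_cat sumn_cat /= map_rcons -cats1 sumn_cat /=; lia.
rewrite E nthE addnC wpart_cat; congr (_ * Fpart _ * _).
  by rewrite drop_size_cat // size_map size_wpart.
rewrite map_cat -map_comp (@eq_map _ _ _ id) ?map_id; last by move=> x /=; rewrite addKn.
rewrite (_ : map _ (wpart u) = nseq (size (wpart u)) 0) ?Fpart_nseq0 //.
have := wpart_le u; elim: (wpart u) => //= x s IH /andP[h /IH->].
by move: h; rewrite -subn_eq0 => /eqP->.
Qed.

(** For a word t1s, row number plus row length at the displayed 1 is [c1 (t1s)] minus the height of
    t. A maximal node thus sits where a 1 leaves a lowest point, and the first such row is the
    rightmost such 1. It cuts [v] as [q ++ true :: s]; induction applies to [u ++ q] and to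
    [q ++ true :: s]. *)
Lemma Fw_cat u v : endmin u -> nonneg v ->
  Fw (u ++ v) = 'C(c0 u + c1 v, c1 v) * Fw u * Fw v.
Proof.
have [n] := ubnP (size (u ++ v)); elim: n u v => // n IH u v /ltnSE-le_n eu /nonnegP nv.
case: (posnP (size u)) => [/size0nil-> | szu].
  by rewrite binn mul1n mul1n.
case: v le_n nv => [|[] v] le_n nv.
- by rewrite cats0 bin0 muln1 mul1n.
- have pu : 0 < c0 u by have := eu [::] u erefl; have := count_predC id u; rewrite -[count (predC id) u]/(c0 u); lia.
  set w := u ++ true :: v.
  have pos : sumn (wpart w) != 0.
    apply/negP=> /eqP; rewrite wpart_cat sumn_cat /= map_rcons -cats1 sumn_cat /=; lia.
  have [rlt pr mr lr] := node_rowP pos; set r := node_row _ in rlt pr mr lr.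
  have nthE : nth 0 (wpart w) (c1 v) = c0 u.
    rewrite wpart_cat nth_cat size_map size_wpart /= add1n ltnSn.
    by rewrite (nth_map 0) ?size_rcons ?size_wpart // nth_rcons size_wpart ltnn eqxx addn0.
  have h1 : r <= c1 v.
    rewrite leqNgt; apply/negP=> lt; have := lr _ lt; rewrite nthE => /(_ pu).
    rewrite size_wpart in rlt; have [t [s [Ew Es ->]]] := nth_wpart rlt.
    have := Ew; rewrite /w => /cat_eq_cat[[q [Eu Ev]]|[q [Eu Ev]]].
      have := nv [::] _ erefl; move/(congr1 (fun s => c1 s)): Ev; rewrite count_cat /= Es; lia.
    by have := eu _ _ Eu; move/(congr1 (fun s => c1 s)): Ev; rewrite Eu !count_cat /= Es; lia.
  rewrite size_wpart in rlt; have [t [s [Ew Es Et]]] := nth_wpart rlt.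
  have [q [Eu Ev]] : exists q, t = u ++ q /\ true :: v = q ++ true :: s.
    have := Ew; rewrite /w => /esym/cat_eq_cat[[q [Eu Ev]]|//].
    exists [::]; case: q Eu Ev => [|b q] -> /=; first by rewrite !cats0.
    by case=> _ /(congr1 (fun s => c1 s)); rewrite count_cat /= Es; lia.
  (* The ends of [u] and of [u ++ q] are both lowest points, so [q] has height zero. *)
  have hq : c0 q = c1 q.
    have := mr (c1 v); rewrite nthE Et => /(_ pu); have := nv _ _ Ev.
    by move/(congr1 (fun s => c1 s)): (Ev); rewrite Eu !count_cat /= Es; lia.
  have nq : nonneg q.
    by apply/nonnegP=> p p' E; apply: (nv p (p' ++ true :: s)); rewrite Ev E catA.
  have ns : nonneg (true :: s).
    apply/nonnegP=> p p' E; have := nv (q ++ p) p'; rewrite Ev E catA => /(_ erefl).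
    by rewrite !count_cat hq leq_add2l.
  have eq : endmin q.
    move=> p p' E; have := nv p (p' ++ true :: s).
    by rewrite Ev E catA => /(_ erefl); move: hq; rewrite E !count_cat; lia.
  have := le_n; rewrite size_cat Ev size_cat /= => sz.
  rewrite /w Ev catA Fpart_split -?catA -?Ev ?Es //; last first.
    by rewrite count_cat; lia.
  rewrite (IH u q) ?size_cat //; last by lia.
  rewrite Ev (IH q (true :: s)) ?size_cat //=; last by lia.
  have := multinomial_assoc (c0 u) (c1 q) r.+1.
  rewrite !count_cat /= Es hq add1n !addnA => M.
  transitivity (('C(c0 u + c1 q + r.+1, r.+1) * 'C(c0 u + c1 q, c1 q)) * Fw u * Fw q * Fw (true :: s)); first by ring.
  by rewrite M; ring.
by have := nv [:: false] v erefl.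
Qed.

Local Open Scope ring_scope.

(** * Weighted sums over words with one letter changed *)

Definition height (z : seq bool) : int := (c1 z)%:Z - (c0 z)%:Z.

(* The sum of (1 + height z) phi (x 1 z) over the factorisations w = x 0 z with
   z nonnegative. *)
Fixpoint up_sum (phi : seq bool -> int) (w : seq bool) : int :=
  if w is c :: w' then
    (if ~~ c && nonneg w' then (1 + height w') * phi (true :: w') else 0)
    + up_sum (fun x => phi (c :: x)) w'
  else 0.

(* The sum of (1 + height z) phi (x 0 z) over the factorisations w = x 1 z with
   z nonnegative. *)
Fixpoint down_sum (phi : seq bool -> int) (w : seq bool) : int :=
  if w is c :: w' then
    (if c && nonneg w' then (1 + height w') * phi (false :: w') else 0)
    + down_sum (fun x => phi (c :: x)) w'
  else 0.

(* The value at v of the lowering operator of sl_2 applied to phi: the sum of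
   phi (x 1 z) over the factorisations v = x 0 z. *)
Fixpoint lower_sum (phi : seq bool -> int) (v : seq bool) : int :=
  if v is c :: v' then
    (if ~~ c then phi (true :: v') else 0) + lower_sum (fun x => phi (c :: x)) v'
  else 0.

Lemma up_sum_ext phi psi w :
  (forall p q, w = p ++ false :: q -> phi (p ++ true :: q) = psi (p ++ true :: q)) ->
  up_sum phi w = up_sum psi w.
Proof.
elim: w phi psi => //= c w IH phi psi h; congr (_ + _).
  by case: c h => //= /(_ [::] w erefl) /= ->.
by apply: IH => p q E; apply: (h (c :: p)); rewrite E.
Qed.

Lemma down_sum_ext phi psi w :
  (forall p q, w = p ++ true :: q -> phi (p ++ false :: q) = psi (p ++ false :: q)) ->
  down_sum phi w = down_sum psi w.
Proof.
elim: w phi psi => //= c w IH phi psi h; congr (_ + _).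
  by case: c h => //= /(_ [::] w erefl) /= ->.
by apply: IH => p q E; apply: (h (c :: p)); rewrite E.
Qed.

Lemma lower_sum_ext phi psi v :
  (forall p q, v = p ++ false :: q -> phi (p ++ true :: q) = psi (p ++ true :: q)) ->
  lower_sum phi v = lower_sum psi v.
Proof.
elim: v phi psi => //= c w IH phi psi h; congr (_ + _).
  by case: c h => //= /(_ [::] w erefl) /= ->.
by apply: IH => p q E; apply: (h (c :: p)); rewrite E.
Qed.

Lemma up_sum_scale k phi w : up_sum (fun x => k * phi x) w = k * up_sum phi w.
Proof.
elim: w phi => [|c w IH] phi /=; first by rewrite mulr0.
by rewrite IH mulrDr mulrCA; case: ifP; rewrite ?mulr0.
Qed.

Lemma down_sum_scale k phi w : down_sum (fun x => k * phi x) w = k * down_sum phi w.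
Proof.
elim: w phi => [|c w IH] phi /=; first by rewrite mulr0.
by rewrite IH mulrDr mulrCA; case: ifP; rewrite ?mulr0.
Qed.

Lemma lower_sum_scale k phi v : lower_sum (fun x => k * phi x) v = k * lower_sum phi v.
Proof.
elim: v phi => [|c w IH] phi /=; first by rewrite mulr0.
by rewrite IH mulrDr; case: ifP; rewrite ?mulr0.
Qed.

Lemma lower_sum_sum (I : Type) (r : seq I) (phi : I -> seq bool -> int) v :
  lower_sum (fun x => \sum_(i <- r) phi i x) v = \sum_(i <- r) lower_sum (phi i) v.
Proof.
elim: v phi => [|c w IH] phi /=; first by rewrite big1.
by rewrite IH big_split /=; case: c => /=; first by rewrite [X in _ = X + _]big1.
Qed.

Lemma lower_sum_const k v : lower_sum (fun=> k) v = (c0 v)%:Z * k.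
Proof.
elim: v => [|c w IH] /=; first by rewrite mul0r.
by rewrite IH PoszD mulrDl; case: c; rewrite /= ?mul0r ?mul1r.
Qed.

Lemma lower_sum_cat phi v s :
  lower_sum phi (v ++ s) = lower_sum (fun x => phi (x ++ s)) v + lower_sum (fun x => phi (v ++ x)) s.
Proof. by elim: v phi => [|c v IH] phi /=; rewrite ?add0r // IH addrA. Qed.

(** * The eigenvalue identity for [Fw] *)

Lemma endmin_cons c u : endmin (c :: u) -> endmin u.
Proof. by move=> h p q E; apply: (h (c :: p)); rewrite E. Qed.

(** The displayed 0 is the step by which the height first reaches its overall minimum; if that
    minimum is the starting height, the word is nonnegative. *)
Lemma first_min w :
  nonneg w \/ exists u v, [/\ w = u ++ false :: v, endmin u & nonneg v].
Proof.
elim: w => [|c w [nw|[u [v [-> eu nv]]]]]; first by left.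
  case: c; first by left; apply: nonneg_cons1.
  by right; exists [::], w; split=> //; apply: endmin_nil.
case: c; last first.
  right; exists (false :: u), v; split=> // -[|b p] q /=; last by case=> _; apply: eu.
  by move=> <-; have := eu [::] u erefl; rewrite /=; lia.
(* As [endmin u] gives [c1 u <= c0 u], the other case is equality: the new 1 then compensates the
   displayed 0 and the whole word is nonnegative. *)
case: (ltnP (c1 u) (c0 u)) => hu.
  right; exists (true :: u), v; split=> // -[|b p] q /=; last by case=> _; apply: eu.
  by move=> <- /=; lia.
left; rewrite -[_ :: _]/((true :: u) ++ [:: false] ++ v) catA; apply: nonneg_cat nv.
apply/nonnegP=> [[|b p] q] //= [<- /esym/cat_eq_cat[[t [E _]]|[[|b' t] [-> E]]]].
- by have := eu _ _ E; move: hu; rewrite E !count_cat; lia.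
- by have := eu [::] u erefl; rewrite cats0 /=; lia.
by case: E => <- /esym; case: t => //= _; rewrite !count_cat /=; have := eu [::] u erefl; rewrite /=; lia.
Qed.

(** Cutting at a 0 inside [u] leaves a remainder starting with a suffix of [u] and the displayed 0;
    this start has negative height, so the term vanishes. *)
Lemma up_sum_endmin phi u v : endmin u ->
  up_sum phi (u ++ false :: v) = up_sum (fun x => phi (u ++ x)) (false :: v).
Proof.
elim: u phi => //= c u IH phi /endmin_cons eu; rewrite IH //=.
case: ifP => [|_]; last by rewrite add0r.
case/andP=> _ /nonnegP/(_ (u ++ [:: false]) v); rewrite -catA => /(_ erefl).
by rewrite !count_cat /=; have := eu [::] u erefl; lia.
Qed.

Lemma up_sum_Fw w : up_sum (fun x => (Fw x)%:Z) w = (c0 w)%:Z * (Fw w)%:Z.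
Proof.
have [n] := ubnP (size w); elim: n w => // n IH w /ltnSE-le_n.
case: (first_min w) => [|[u [v [Ew eu nv]]]].
  case: w le_n => [|[] w] //= le_n; last by rewrite nonneg_cons0.
  move=> _; rewrite add0r add0n Fw_cons1 -IH //.
  by apply: up_sum_ext => p q _; rewrite Fw_cons1.
have eu0 : endmin (rcons u false).
  move=> p q; rewrite -cats1 => /esym/cat_eq_cat[[t [E ->]]|[[|b' t] [_ E]]].
  - by have := eu _ _ E; rewrite !count_cat /=; lia.
  - by move: E => /= <-.
  by case: E => _ /esym; case: t => // /=; case: q.
rewrite Ew up_sum_endmin //= nv -[u ++ false :: v]cat_rcons.
have -> : up_sum (fun x => (Fw (u ++ false :: x))%:Z) v =
   ('C((c0 u).+1 + (c1 v).+1, (c1 v).+1) * Fw u)%:Z * ((c0 v)%:Z * (Fw v)%:Z).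
  rewrite -IH -?up_sum_scale; last by move: le_n; rewrite Ew size_cat /=; lia.
  apply: up_sum_ext => p q Ev; rewrite -cat_rcons Fw_cat //; last first.
    by apply: nonneg_flip; rewrite -Ev.
  rewrite Fw_rcons0 -cats1 Ev !count_cat /= -PoszM.
  by congr Posz; congr ('C(_, _) * _ * _)%N; lia.
rewrite !Fw_cat ?Fw_rcons0 ?nonneg_cons1 // Fw_cons1 -cats1 !count_cat /= !addn0 add1n addn1.
(* With N = c0 u + 1 + c1 v and m = c1 v, this is (m+1) C(N,m+1) = (N-m) C(N,m), where N - m = c0 u
   + 1; Pascal's rule rewrites the coefficient coming from the 0's of [v]. *)
have := mul_bin_left ((c0 u).+1 + c1 v) (c1 v); rewrite addnK.
rewrite !addSn addnS [X in (X * _)%:Z * _]binS /height.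
move: ('C(_, c1 v)) ('C(_, (c1 v).+1)) => A D E.
rewrite !PoszM !PoszD.
have {}E : ((c1 v)%:Z + 1) * D%:Z = ((c0 u)%:Z + 1) * A%:Z by lia.
transitivity ((((c1 v)%:Z + 1) * D%:Z + (c0 v)%:Z * A%:Z) * (Fw u)%:Z * (Fw v)%:Z).
  by ring.
by rewrite E -addn1 !PoszD; ring.
Qed.

(** * Cup vectors and their local relations *)

Definition antisym (d c : bool) : int := if d == c then 0 else if d then 1 else -1.

(* cup_coef [::] w v is the coefficient of the word v in the vector obtained from w
   by replacing each matched pair 1...0 with the antisymmetric tensor
   10 - 01; st holds the letters of v facing the pending 1's of w. *)
Fixpoint cup_coef (st : seq bool) (w v : seq bool) : int :=
  match w, v with
  | [::], [::] => (all id st)%:R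
  | true :: w', c :: v' => cup_coef (c :: st) w' v'
  | false :: w', c :: v' =>
      if st is d :: st' then antisym d c * cup_coef st' w' v'
      else if c then 0 else cup_coef [::] w' v'
  | _, _ => 0
  end.

Definition cup_vec := cup_coef [::].

Lemma cup_coef_insert st p q v1 v2 c d : size v1 = size p ->
  cup_coef st (p ++ true :: false :: q) (v1 ++ c :: d :: v2) = antisym c d * cup_coef st (p ++ q) (v1 ++ v2).
Proof.
elim: p v1 st => [|[] p IH] [|b v1] st //= [sz]; first exact: IH.
case: st => [|a st]; last by rewrite IH // mulrCA.
by case: b; rewrite ?mulr0 // IH.
Qed.

(** Popping a bottom letter 1 gives [antisym true c], which is 1 for the letter 0 and 0 for the
    letter 1, exactly as for an unmatched 0; left unpopped, it passes [all id]. *)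
Lemma cup_coef_bottom1 st w v : cup_coef (rcons st true) w v = cup_coef st w v.
Proof.
elim: w v st => [|[] w IH] [|c v] st //=.
- by rewrite all_rcons.
- by rewrite -rcons_cons IH.
case: st => [|a st] /=; last by rewrite IH.
by case: c; rewrite /antisym /= ?mul0r ?mul1r.
Qed.

(** There are too few 0's in [w] to pop the bottom letter, so the final test [all id] fails. *)
Lemma cup_coef_bottom0 st w v : (c0 w <= size st)%N -> cup_coef (rcons st false) w v = 0.
Proof.
elim: w v st => [|[] w IH] [|c v] st //=.
- by rewrite all_rcons.
- by move=> h; rewrite -rcons_cons IH //= ltnW.
by case: st => [|a st] //= h; rewrite IH ?mulr0.
Qed.

(** This is how s_i turns an adjacent 01 into a matched 10. If a faces the top pending 1, it is the
    three-term relation (ad)c - (ac)d = (cd)a for the form [antisym]; an empty stack behaves as a =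
    1 by [cup_coef_bottom1]. *)
Lemma cup_coef_swap st x y v1 v2 c d : size v1 = size x ->
  cup_coef st (x ++ false :: true :: y) (v1 ++ d :: c :: v2)
  - cup_coef st (x ++ false :: true :: y) (v1 ++ c :: d :: v2)
  = cup_coef st (x ++ true :: false :: y) (v1 ++ c :: d :: v2).
Proof.
elim: x v1 st => [|[] x IH] [|b v1] st //=.
- case: st => [|a st] _.
    have /= b1 := cup_coef_bottom1 [::].
    by case: c; case: d; rewrite ?b1 /antisym /=; ring.
  by case: a; case: c; case: d; rewrite /antisym /=; ring.
- by case=> sz; apply: IH.
case=> sz; case: st => [|a st]; last by rewrite -mulrBr IH.
by case: b; [rewrite subr0 | apply: IH].
Qed.

(** A matched pair faces exactly one 0, and an unmatched letter faces itself. *)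
Lemma cup_coef_count st w v : cup_coef st w v != 0 -> (c0 st + c0 v = c0 w)%N.
Proof.
elim: w v st => [|[] w IH] [|c v] st //=; rewrite ?eqxx //.
- rewrite addn0; case: (boolP (all id st)) => // + _.
  by elim: st => //= -[].
- by move/IH => /=; lia.
case: st => [|a st] /=.
  by case: c; rewrite ?eqxx // => /IH /=; lia.
by rewrite mulf_eq0 negb_or => /andP[+ /IH]; case: a; case: c; rewrite /antisym /=; lia.
Qed.

Lemma cup_coef_nseq1 st n v : size v = n -> cup_coef st (nseq n true) v = (all id v && all id st)%:R.
Proof.
elim: n v st => [|n IH] [|c v] st //= [sz].
by rewrite IH //= andbA [c && _]andbC.
Qed.

(** * The lowering operator on cup vectors *)

Lemma word_cases w : [\/ exists n, w = nseq n true, exists w', w = false :: w'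
  | exists p q, w = p ++ true :: false :: q].
Proof.
elim: w => [|c w IH]; first by constructor 1; exists 0%N.
case: c; last by constructor 2; exists w.
case: IH => [[n ->]|[w' ->]|[p [q ->]]].
- by constructor 1; exists n.+1.
- by constructor 3; exists [::], w'.
by constructor 3; exists (true :: p), q.
Qed.

Lemma nonneg_nseq1 n : nonneg (nseq n true).
Proof. by elim: n => // n; apply: nonneg_cons1. Qed.

Lemma height_nseq1 n : height (nseq n true) = n%:Z.
Proof. by rewrite /height !count_nseq /= mul1n mul0n subr0. Qed.

Lemma nseq1_flip n p q : nseq n true = p ++ true :: q -> c0 (p ++ false :: q) = 1%N.
Proof.
move=> E; have /(congr1 (fun s => c0 s)) := E.
by rewrite count_nseq !count_cat /=; lia.
Qed.

(** Only the 0 made from the first 1 can pop the pending letter 0; its weight is [n], and [antisym]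
    supplies the sign. *)
Lemma down_sum_nseq1_pending0 n v : size v = n ->
  down_sum (fun x => cup_coef [:: false] x v) (nseq n true) = - (n%:Z * (all id v)%:R).
Proof.
case: n v => [|n] [|c v] // [sz].
rewrite /= nonneg_nseq1 height_nseq1 cup_coef_nseq1 // (@down_sum_ext _ (fun=> 0 * 0)).
  by rewrite down_sum_scale; case: c; rewrite /antisym /= ?andbT; lia.
by move=> p q /nseq1_flip h; rewrite mul0r (@cup_coef_bottom0 [:: c]) ?h.
Qed.

(** Flipping the inserted 1 leaves a remainder starting with 0, hence no term; the pair changes
    neither the height nor the nonnegativity of the other remainders. *)
Lemma down_sum_insert phi psi p q :
  (forall p' q', size p' = size p -> phi (p' ++ true :: false :: q') = psi (p' ++ q')) ->
  down_sum phi (p ++ true :: false :: q) = down_sum psi (p ++ q).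
Proof.
elim: p phi psi => [|c p IH] phi psi h /=.
  rewrite nonneg_cons0 !add0r; apply: down_sum_ext => a b _.
  by rewrite (h [::]).
rewrite nonneg_insert (IH _ (fun x => psi (c :: x))); last first.
  by move=> p' q' sz; rewrite -cat_cons h //= sz.
congr (_ + _); case: ifP => // _; rewrite -cat_cons h //.
by congr (_ * _); rewrite /height !count_cat /=; lia.
Qed.

Lemma lower_sum_cup_vec w v : size v = size w -> lower_sum (cup_vec w) v = down_sum (fun x => cup_vec x v) w.
Proof.
have [n] := ubnP (size w); elim: n w v => // n IH w v /ltnSE-le_n.
case: (word_cases w) => [[m ->]|[w' Ew]|[p [q Ew]]].
- rewrite size_nseq => sz {w le_n n IH}; elim: m v sz => [|n IH] [|c v] //= [sz].
  rewrite nonneg_nseq1 height_nseq1 /cup_vec /= !cup_coef_nseq1 //=.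
  case: c.
    rewrite mulr0 (@down_sum_ext _ (fun x => cup_vec x v)); last first.
      by move=> p q _; apply: (cup_coef_bottom1 [::]).
    rewrite -IH // !add0r; apply: lower_sum_ext => p q E.
    have {}sz : size (p ++ true :: q) = n by rewrite -sz E !size_cat.
    by rewrite /cup_vec !cup_coef_nseq1 //= andbT.
  (* Flipping the first 1 has weight n + 1, and the later flips contribute -n, which leaves 1. *)
  rewrite down_sum_nseq1_pending0 // (@lower_sum_ext _ (fun=> 0)) ?lower_sum_const ?mulr0.
    by rewrite andbT; ring.
  move=> p q E; have {}sz : size (p ++ true :: q) = n by rewrite -sz E !size_cat.
  by rewrite cup_coef_nseq1 // andbF.
- rewrite {w}Ew in le_n *; case: v => // c v [sz].
  rewrite /= add0r; case: c.
    rewrite (@down_sum_ext _ (fun=> 0 * 0)) ?down_sum_scale; last by move=> *; rewrite mul0r.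
    by rewrite add0r mul0r (@lower_sum_ext _ (fun=> 0)) ?lower_sum_const ?mulr0.
  by rewrite add0r IH.
rewrite {w}Ew in le_n * => sz.
have [v1 [c [d [v2 [Ev s1]]]]] : exists v1 c d v2, v = v1 ++ c :: d :: v2 /\ size v1 = size p.
  exists (take (size p) v), (nth false v (size p)), (nth false v (size p).+1), (drop (size p).+2 v).
  rewrite size_cat /= in sz; rewrite -!drop_nth ?sz; try lia.
  by rewrite cat_take_drop size_takel ?sz ?leq_addr.
have s2 : size v2 = size q by move: sz; rewrite Ev !size_cat /= s1; lia.
rewrite (@down_sum_insert _ (fun x => antisym c d * cup_vec x (v1 ++ v2))); last first.
  by move=> p' q' s'; rewrite Ev /cup_vec cup_coef_insert // s1 s'.
rewrite down_sum_scale -IH; [| by move: le_n; rewrite !size_cat /=; lia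
                         | by rewrite !size_cat s1 s2].
rewrite Ev !lower_sum_cat /= mulrDr -!lower_sum_scale.
rewrite (@lower_sum_ext _ (fun x => antisym c d * cup_vec (p ++ q) (x ++ v2)) v1); last first.
  move=> a b E; rewrite /cup_vec cup_coef_insert // -s1 E !size_cat //.
rewrite (@lower_sum_ext _ (fun x => antisym c d * cup_vec (p ++ q) (v1 ++ x)) v2); last first.
  by move=> a b E; rewrite /cup_vec cup_coef_insert.
congr (_ + _); rewrite addrA -[RHS]add0r; congr (_ + _).
(* The two changes at the letters facing the pair cancel, as 10 - 01 is killed by lowering. *)
by rewrite /cup_vec !cup_coef_insert //; case: c {Ev}; case: d; rewrite /antisym /=; ring.
Qed.

(** * Summation over all words of a given length *)

Fixpoint words (k : nat) : seq (seq bool) :=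
  if k is k'.+1 then map (cons false) (words k') ++ map (cons true) (words k')
  else [:: [::]].

Lemma mem_words k w : (w \in words k) = (size w == k).
Proof.
elim: k w => [|k IH] [|c w] //=.
  by rewrite mem_cat; apply/negP => /orP[] /mapP[].
rewrite mem_cat eqSS -IH; apply/orP/idP => [[] /mapP[x xin [_ ->]] // | win].
by case: c; [right|left]; apply/mapP; exists w.
Qed.

Lemma uniq_words k : uniq (words k).
Proof.
elim: k => //= k IH; have inj b : injective (cons b) by move=> x y [].
rewrite cat_uniq !(map_inj_uniq (inj _ _)) IH andbT; apply/hasPn => x /mapP[y _ ->].
by apply/mapP => -[].
Qed.

(** The weight depends on z only, so both sides run over the same pairs x1z, x0z. *)
Lemma sum_words_adjoint k (psi phi : seq bool -> int) :
  \sum_(w <- words k) psi w * down_sum phi w = \sum_(w <- words k) up_sum psi w * phi w.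
Proof.
elim: k psi phi => [|k IH] psi phi /=.
  by rewrite !big_seq1 /= mulr0 mul0r.
rewrite !big_cat !big_map /=.
under eq_bigr do rewrite add0r.
under [X in _ + X = _]eq_bigr do rewrite mulrDr.
under [X in _ = X + _]eq_bigr do rewrite mulrDl.
under [X in _ = _ + X]eq_bigr do rewrite add0r.
rewrite !big_split /= !IH addrCA -addrA; congr (_ + _).
by apply: eq_bigr => w _; case: ifP; rewrite ?mulr0 ?mul0r // => _; ring.
Qed.

(** Stated over the integers, where the number of 0's can be cancelled; the identity over any field
    is its image. *)
Lemma sum_Fw_cup_vec k v : size v = k -> \sum_(w <- words k) (Fw w)%:Z * cup_vec w v = 1.
Proof.
have [n] := ubnP (c0 v); elim: n v => // n IH v /ltnSE-le_n sz.
case: (posnP (c0 v)) => hv.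
  have Ev : v = nseq k true.
    rewrite -sz; elim: v hv {le_n sz} => //= -[] v IHv //= h; rewrite -IHv //.
  rewrite (bigD1_seq (nseq k true)) ?uniq_words ?mem_words ?size_nseq //=.
  rewrite Fw_nseq1 Ev /cup_vec cup_coef_nseq1 ?size_nseq // andbT all_nseq orbT mulr1.
  rewrite big_seq_cond big1 ?addr0 // => w /andP[]; rewrite mem_words => /eqP szw.
  case: (eqVneq (cup_coef [::] w (nseq k true)) 0) => [-> | /cup_coef_count h]; first by rewrite mulr0.
  case/eqP; rewrite -szw; move: h; rewrite count_nseq /= mul0n addn0 => /esym.
  by elim: w {szw} => //= -[] w IHw //= h; rewrite -IHw.
(* Lowering only involves words with one 0 fewer, where the sum is 1 by induction; hence [c0 v] is
   the lowered sum at [v]. *)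
apply: (@mulfI _ (c0 v)%:Z); first by rewrite -lt0n in hv *; lia.
rewrite mulr1 -{2}[(c0 v)%:Z]mulr1 -(lower_sum_const 1).
rewrite -(@lower_sum_ext (fun x => \sum_(w <- words k) (Fw w)%:Z * cup_vec w x)); last first.
  move=> p q E; apply: IH; last by rewrite -sz E !size_cat.
  by move: le_n; rewrite E !count_cat /=; lia.
rewrite lower_sum_sum.
transitivity (\sum_(w <- words k) (Fw w)%:Z * down_sum (fun x => cup_vec x v) w); last first.
  rewrite big_seq [RHS]big_seq; apply: eq_bigr => w; rewrite mem_words => /eqP szw.
  by rewrite lower_sum_scale lower_sum_cup_vec // sz.
rewrite sum_words_adjoint mulr_sumr; apply: eq_bigr => w _.
rewrite up_sum_Fw; case: (eqVneq (cup_vec w v) 0) => [-> | /cup_coef_count /= <-]; first by rewrite !mulr0.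
by rewrite mulrA.
Qed.

(** * Partitions in a rectangle as words *)

Definition geR : rel nat := fun a b => (b <= a)%N.

(** The inverse of [wpart]: the first row [x] is the rightmost 1, followed by the [f - x] remaining
    0's. *)
Fixpoint pword (f : nat) (l : seq nat) : seq bool :=
  if l is x :: l' then pword x l' ++ true :: nseq (f - x) false else nseq f false.

Lemma path_geR_widen x f l : (x <= f)%N -> path geR x l -> path geR f l.
Proof. by case: l => //= y l xf /andP[yx ->]; rewrite /geR (leq_trans yx). Qed.

Lemma pword_widen x f l : (x <= f)%N -> path geR x l -> pword f l = pword x l ++ nseq (f - x) false.
Proof.
case: l => [|y l] xf /=; first by rewrite -nseqD subnKC.
by rewrite /geR => /andP[yx _]; rewrite -catA /= -nseqD; congr (_ ++ _ :: nseq _ _); lia.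
Qed.

Lemma size_pword f l : path geR f l -> size (pword f l) = (f + size l)%N.
Proof.
elim: l f => [|x l IH] f /=; first by rewrite size_nseq addn0.
by case/andP=> xf /IH E; rewrite size_cat E /= size_nseq; rewrite /geR in xf; lia.
Qed.

Lemma c0_pword f l : path geR f l -> c0 (pword f l) = f.
Proof.
elim: l f => [|x l IH] f /=; first by rewrite count_nseq mul1n.
by case/andP=> xf /IH E; rewrite count_cat E /= count_nseq mul1n subnKC.
Qed.

Lemma wpart_nseq0 n : wpart (nseq n false) = [::].
Proof. by elim: n => //= n ->. Qed.

Lemma pwordK f l : path geR f l -> wpart (pword f l) = l.
Proof.
elim: l f => [|x l IH] f /=; first by rewrite wpart_nseq0.
by case/andP=> xf pl; rewrite wpart_cat /= wpart_nseq0 /= addn0 c0_pword // IH.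
Qed.

Lemma pword_rcons0 f l : pword f (rcons l 0%N) = true :: pword f l.
Proof. by elim: l f => [|x l IH] f /=; rewrite ?subn0 // IH. Qed.

Lemma pword_succ f l : pword f.+1 (map succn l) = false :: pword f l.
Proof. by elim: l f => [|x l IH] f //=; rewrite IH subSS. Qed.

Lemma wpartK w : pword (c0 w) (wpart w) = w.
Proof. by elim: w => [|[] w IH] //=; rewrite ?add1n ?pword_rcons0 ?pword_succ IH. Qed.

Lemma path_wpart w : path geR (c0 w) (wpart w).
Proof.
elim: w => [|[] w IH] //=; first by rewrite rcons_path IH.
by rewrite add1n path_map.
Qed.

Lemma is_partE f g (t : g.-tuple 'I_f.+1) : is_part t = path geR f (map val t).
Proof.
rewrite /is_part -[fun a b => _]/geR; case: (tval t) => [|x s] //=.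
by rewrite {2}/geR -ltnS ltn_ord.
Qed.

Lemma sum_part_words (V : nmodType) (Phi : seq nat -> V) f g :
  \sum_(t : g.-tuple 'I_f.+1 | is_part t) Phi (map val t) =
  \sum_(w <- words (f + g) | c0 w == f) Phi (wpart w).
Proof.
rewrite -big_filter -(big_map (fun t : g.-tuple 'I_f.+1 => map val t) predT Phi).
rewrite -[RHS]big_filter -[RHS](big_map wpart predT Phi).
apply: perm_big; apply: uniq_perm.
- rewrite map_inj_uniq ?filter_uniq ?index_enum_uniq // => s t /(inj_map val_inj).
  exact: val_inj.
- rewrite map_inj_in_uniq ?filter_uniq ?uniq_words // => s t.
  rewrite !mem_filter => /andP[/eqP Es _] /andP[/eqP Et _] E.
  by rewrite -(wpartK s) -(wpartK t) E Es Et.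
move=> l; apply/mapP/mapP => [[t] | [w]]; rewrite mem_filter.
  rewrite is_partE => /andP[pt _] ->; exists (pword f (map val t)); last by rewrite pwordK.
  by rewrite mem_filter c0_pword // mem_words size_pword // size_map size_tuple !eqxx.
rewrite mem_words => /andP[/eqP cw /eqP szw ->].
have sz : size (map (fun x => inord x : 'I_f.+1) (wpart w)) == g.
  rewrite size_map size_wpart -(eqn_add2l f) -szw -(count_predC id w) addnC -cw.
  by rewrite eqn_add2l.
have E : wpart w = map val (Tuple sz).
  rewrite -map_comp -[LHS]map_id; apply/eq_in_map => x /(allP (wpart_le w)).
  by rewrite cw /= => xf; rewrite inordK.
exists (Tuple sz) => //; rewrite mem_filter mem_index_enum andbT is_partE -E -cw.
exact: path_wpart.
Qed.

(** Removing the first row lowers both g and r by one, so the differences g - r in the other rows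
    persist. *)
Lemma lam_index_cons f g x l : lam_index f g.+1 (x :: l) =
  iota (x + g).+1 (f - x) ++ lam_index f g l.
Proof.
rewrite /lam_index /= subSS subn0 addn1; congr (_ ++ flatten _).
rewrite (iotaDl 1 1) -map_comp; apply/eq_in_map => r.
by rewrite mem_iota /= => /andP[r1 _]; rewrite subSS; case: r r1.
Qed.

Lemma cup_vec_base n m v : size v = (n + m)%N ->
  cup_vec (nseq n false ++ nseq m true) v = (v == nseq n false ++ nseq m true)%:R.
Proof.
elim: n v => [|n IH] v /= szv.
  rewrite /cup_vec cup_coef_nseq1 // andbT; congr (nat_of_bool _)%:R; rewrite add0n in szv.
  by rewrite -szv; elim: v {szv} => //= -[] v IH; rewrite eqseq_cons //= IH.
by case: v szv => // -[] v [szv] //=; rewrite /cup_vec /= -/cup_vec IH // eqseq_cons.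
Qed.

(** * The group algebra acting on words *)

Section Evaluation.
Variables (F : fieldType) (k f : nat).
Implicit Types (s t p q : 'S_k) (x y : GA F k) (v : seq bool).

(** The word s m. As [(p * s) j = s (p j)], left multiplication permutes positions, while right
    multiplication by a permutation preserving the first [f] points changes nothing. *)
Definition act s : seq bool := [seq (f <= s j)%N | j <- enum 'I_k].

Lemma size_act s : size (act s) = k.
Proof. by rewrite size_map size_enum_ord. Qed.

Lemma nth_act s (j : 'I_k) : nth false (act s) j = (f <= s j)%N.
Proof. by rewrite (nth_map j) ?size_enum_ord // nth_ord_enum. Qed.

Lemma act_eqP s t : act s = act t <-> (forall j, (f <= s j)%N = (f <= t j)%N).
Proof.
split=> [E j | h]; first by rewrite -!nth_act E.
by apply: eq_map.
Qed.

Lemma act1 : (f <= k)%N -> act 1%g = nseq f false ++ nseq (k - f) true.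
Proof.
move=> fk; apply: (@eq_from_nth _ false) => [|i].
  by rewrite size_act size_cat !size_nseq subnKC.
rewrite size_act => ik; rewrite -[i]/(nat_of_ord (Ordinal ik)) nth_act perm1 /=.
by rewrite nth_cat !nth_nseq size_nseq if_same; case: ltnP => // h; rewrite ltn_sub2r ?(leq_ltn_trans h).
Qed.

Lemma tgenE i (j : 'I_k) : (0 < i < k)%N ->
  tgen k i j = (if j == i.-1 :> nat then i else if j == i :> nat then i.-1 else j) :> nat.
Proof.
rewrite /tgen; case: k j => [|k'] j; first by case: j.
move=> h; rewrite h; case/andP: h => i0 ik.
have e1 : (inord i.-1 : 'I_k'.+1) = i.-1 :> nat by rewrite inordK; lia.
have e2 : (inord i : 'I_k'.+1) = i :> nat by rewrite inordK.
case: tpermP => [->|->|/eqP n1 /eqP n2].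
- by rewrite e1 eqxx.
- by rewrite e2 eqxx; case: eqP => //; lia.
by rewrite -!val_eqE /= e1 e2 in n1 n2; rewrite (negPf n1) (negPf n2).
Qed.

Lemma act_tgen s u1 u2 a b : act s = u1 ++ a :: b :: u2 ->
  act (tgen k (size u1).+1 * s)%g = u1 ++ b :: a :: u2.
Proof.
move=> E; have := size_act s; rewrite E size_cat /= => szk.
apply: (@eq_from_nth _ false) => [|i].
  by rewrite size_act size_cat /=.
rewrite size_act => ik; rewrite -{1}[i]/(nat_of_ord (Ordinal ik)) nth_act permM.
rewrite -nth_act tgenE /=; last by lia.
rewrite E !nth_cat; case: (ltngtP i (size u1)) => [h|h|->]; last first.
- by rewrite ltnNge leqnSn subSnn subnn.
- case: eqP => [->|ne] /=.
    by rewrite ltnn subnn subSnn.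
  rewrite (ltnNge i) (ltnW h) /=; case E': (i - size u1)%N => [|[|m]] //=; lia.
by case: eqP => [|_]; [lia | rewrite h].
Qed.

Lemma act_tgen_eq s v1 v2 c d : size (v1 ++ c :: d :: v2) = k ->
  (act (tgen k (size v1).+1 * s)%g == v1 ++ c :: d :: v2) = (act s == v1 ++ d :: c :: v2).
Proof.
move=> sz.
have [u1 [a [b [u2 [E s1]]]]] : exists u1 a b u2,
    act s = u1 ++ a :: b :: u2 /\ size u1 = size v1.
  exists (take (size v1) (act s)), (nth false (act s) (size v1)),
    (nth false (act s) (size v1).+1), (drop (size v1).+2 (act s)).
  rewrite size_cat /= in sz; rewrite -!drop_nth ?size_act -?sz; try lia.
  by rewrite cat_take_drop size_takel ?size_act -?sz ?leq_addr.
rewrite -s1 (act_tgen E) E !eqseq_cat // !eqseq_cons.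
by rewrite !andbA -!(andbAC _ _ (_ == c)).
Qed.

(** The coefficient of the word [v] in x m. *)
Definition ev v x : F := \sum_s x s * (act s == v)%:R.

Lemma ev_sub v x y : ev v (x - y) = ev v x - ev v y.
Proof. by rewrite /ev -sumrB; apply: eq_bigr => s _; rewrite !ffunE mulrBl. Qed.

Lemma ev_sum (I : Type) (r : seq I) (P : pred I) (G : I -> GA F k) v :
  ev v (\sum_(i <- r | P i) G i) = \sum_(i <- r | P i) ev v (G i).
Proof.
rewrite /ev exchange_big /=; apply: eq_bigr => s _.
by rewrite sum_ffunE mulr_suml.
Qed.

Lemma ev_scale v c x : ev v (gascale c x) = c * ev v x.
Proof. by rewrite /ev mulr_sumr; apply: eq_bigr => s _; rewrite ffunE mulrA. Qed.

Lemma ev_delta v s : ev v (gdelta F s) = (act s == v)%:R.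
Proof.
rewrite /ev (bigD1 s) //= ffunE eqxx mul1r big1 ?addr0 // => t /negPf ts.
by rewrite ffunE ts mul0r.
Qed.

Lemma gamulBl x x' y : gamul (x - x') y = gamul x y - gamul x' y.
Proof.
by apply/ffunP => s; rewrite !ffunE -sumrB; apply: eq_bigr => p _; rewrite !ffunE mulrBl.
Qed.

Lemma gamulBr x y y' : gamul x (y - y') = gamul x y - gamul x y'.
Proof.
by apply/ffunP => s; rewrite !ffunE -sumrB; apply: eq_bigr => p _; rewrite !ffunE mulrBr.
Qed.

Lemma gamul_deltal p y s : gamul (gdelta F p) y s = y (p^-1 * s)%g.
Proof.
rewrite ffunE (bigD1 p) //= ffunE eqxx mul1r big1 ?addr0 // => t /negPf ts.
by rewrite ffunE ts mul0r.
Qed.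

Lemma gamul_delta p q : gamul (gdelta F p) (gdelta F q) = gdelta F (p * q)%g.
Proof.
apply/ffunP => s; rewrite gamul_deltal !ffunE; congr (nat_of_bool _)%:R.
by apply/eqP/eqP => [<-|->]; rewrite ?mulKVg ?mulKg.
Qed.

Lemma ev_gamul_delta v p y :
  ev v (gamul (gdelta F p) y) = \sum_s y s * (act (p * s)%g == v)%:R.
Proof.
rewrite /ev (reindex_inj (mulgI p)) /=; apply: eq_bigr => s _.
by rewrite gamul_deltal mulKg.
Qed.

Lemma ev_sgen v1 v2 c d y : size (v1 ++ c :: d :: v2) = k ->
  ev (v1 ++ c :: d :: v2) (gamul (sgen F k (size v1).+1) y) =
  ev (v1 ++ d :: c :: v2) y - ev (v1 ++ c :: d :: v2) y.
Proof.
move=> sz; rewrite /sgen gamulBl ev_sub !ev_gamul_delta; congr (_ - _).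
  by apply: eq_bigr => s _; rewrite act_tgen_eq.
by apply: eq_bigr => s _; rewrite mul1g.
Qed.

(** The factor of largest index acts first, so the 1 moves left past the 0's one at a time. *)
Lemma act_foldr_iota s P n Q : act s = P ++ nseq n false ++ true :: Q ->
  act (foldr (fun j acc => tgen k j * acc)%g s (iota (size P).+1 n)) =
  P ++ true :: nseq n false ++ Q.
Proof.
elim: n P => [|n IH] P //= E.
have {}E : act s = rcons P false ++ nseq n false ++ true :: Q by rewrite cat_rcons.
by have := IH _ E; rewrite size_rcons cat_rcons => /act_tgen.
Qed.

Lemma ev_foldr_iota y P n Q : size (P ++ nseq n false ++ true :: Q) = k ->
  (forall v, size v = k -> ev v y = (cup_vec (P ++ nseq n false ++ true :: Q) v)%:~R) ->
  forall v, size v = k ->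
  ev v (foldr (fun j acc => gamul (sgen F k j) acc) y (iota (size P).+1 n)) =
  (cup_vec (P ++ true :: nseq n false ++ Q) v)%:~R.
Proof.
elim: n P => [|n IH] P //= szk E v szv.
have [v1 [c [d [v2 [Ev s1]]]]] : exists v1 c d v2, v = v1 ++ c :: d :: v2 /\ size v1 = size P.
  exists (take (size P) v), (nth false v (size P)), (nth false v (size P).+1), (drop (size P).+2 v).
  rewrite !size_cat /= size_cat /= in szk; rewrite -!drop_nth ?szv; try lia.
  by rewrite cat_take_drop size_takel ?szv //; lia.
have szv' : size (v1 ++ d :: c :: v2) = k by rewrite -szv Ev !size_cat.
rewrite Ev -s1 ev_sgen -?Ev // s1 -(size_rcons P false) !IH ?cat_rcons //.
by rewrite -rmorphB Ev /cup_vec cup_coef_swap.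
Qed.

(** Rows are placed from last to first, with [g] 1's still waiting at the right end; [pword_widen]
    exposes the [f - x] 0's that the next 1 crosses. *)
Lemma act_word l g : (k = f + (size l + g))%N -> path geR f l ->
  act (foldr (fun j acc => tgen k j * acc)%g 1%g (lam_index f (size l) l)) =
  pword f l ++ nseq g true.
Proof.
elim: l g => [|x l IH] g kE /=.
  by move=> _; rewrite act1 kE; [rewrite add0n addKn | lia].
case/andP=> xf pl; rewrite lam_index_cons foldr_cat -(size_pword pl) (@act_foldr_iota _ _ _ (nseq g true)).
  by rewrite -catA.
rewrite (IH g.+1) ?(path_geR_widen xf pl) //; last by rewrite kE /=; lia.
by rewrite (pword_widen xf pl) -catA.
Qed.

Lemma ev_s_word l g : (k = f + (size l + g))%N -> path geR f l ->
  forall v, size v = k ->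
  ev v (foldr (fun j acc => gamul (sgen F k j) acc) (gdelta F 1%g) (lam_index f (size l) l)) =
  (cup_vec (pword f l ++ nseq g true) v)%:~R.
Proof.
elim: l g => [|x l IH] g kE /=.
  move=> _ v szv; rewrite ev_delta act1 kE; last by lia.
  rewrite add0n addKn.
  have : size v = (f + g)%N by rewrite szv.
  by move=> szv'; rewrite cup_vec_base // eq_sym mulrz_nat.
case/andP=> xf pl v szv; rewrite lam_index_cons foldr_cat -(size_pword pl).
rewrite (@ev_foldr_iota _ _ _ (nseq g true)) ?[RHS]catA -?catA //.
  by rewrite !size_cat !size_nseq /= size_nseq size_pword // kE /=; rewrite /geR in xf; lia.
move=> v' szv'; rewrite (IH g.+1) ?(path_geR_widen xf pl) //; last by rewrite kE /=; lia.
by rewrite (pword_widen xf pl) -catA.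
Qed.

(** * The left ideal defining the module *)

Definition in_ideal x : Prop :=
  exists a : nat -> GA F k, x = \sum_(1 <= i < k | i != f) gamul (a i) (sgen F k i).

Lemma in_ideal0 : in_ideal 0.
Proof.
exists (fun=> 0); rewrite big1 // => i _; apply/ffunP => s; rewrite !ffunE big1 // => p _.
by rewrite ffunE mul0r.
Qed.

Lemma in_idealB x y : in_ideal x -> in_ideal y -> in_ideal (x - y).
Proof.
move=> [a ->] [b ->]; exists (fun i => a i - b i); rewrite -sumrB.
by apply: eq_bigr => i _; rewrite gamulBl.
Qed.

Lemma in_idealD x y : in_ideal x -> in_ideal y -> in_ideal (x + y).
Proof.
move=> Jx Jy; rewrite -[y]opprK -[- y]add0r; apply: in_idealB => //.
exact: in_idealB in_ideal0 Jy.
Qed.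

Lemma in_ideal_scale c x : in_ideal x -> in_ideal (gascale c x).
Proof.
move=> [a ->]; exists (fun i => gascale c (a i)); apply/ffunP => s.
rewrite ffunE !sum_ffunE mulr_sumr; apply: eq_bigr => i _.
by rewrite !ffunE mulr_sumr; apply: eq_bigr => p _; rewrite [gascale _ _ _]ffunE mulrA.
Qed.

Lemma in_ideal_gen x i : (0 < i < k)%N -> i != f -> in_ideal (gamul x (sgen F k i)).
Proof.
move=> ik nf; exists (fun j => if j == i then x else 0).
rewrite big_mkcond (bigD1_seq i) ?iota_uniq ?mem_index_iota //= nf eqxx.
rewrite big1 ?addr0 // => j /negPf->; case: ifP => // _.
by apply/ffunP => s; rewrite !ffunE big1 // => p _; rewrite ffunE mul0r.
Qed.

Definition sim s t : Prop := in_ideal (gdelta F s - gdelta F t).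

Lemma sim_refl s : sim s s.
Proof. by rewrite /sim subrr; apply: in_ideal0. Qed.

Lemma sim_trans t s q : sim s t -> sim t q -> sim s q.
Proof. by move=> h1 h2; rewrite /sim -(subrKA (gdelta F t)); apply: in_idealD. Qed.

Lemma sim_tgen s i : (0 < i < k)%N -> i != f -> sim (s * tgen k i)%g s.
Proof.
move=> ik nf; rewrite /sim -gamul_delta -{2}[s]mulg1 -gamul_delta -gamulBr.
exact: in_ideal_gen.
Qed.

Lemma tgen_tperm (i j : 'I_k) : j = i.+1 :> nat -> tgen k j = tperm i j.
Proof.
move=> E; apply/permP => l; apply: val_inj; rewrite /= tgenE ?E ?ltn0Sn -?E ?ltn_ord //.
rewrite E /= -E; case: tpermP => [->|->|/eqP n1 /eqP n2]; rewrite ?eqxx //.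
  by rewrite E gtn_eqF.
by rewrite -!val_eqE /= in n1 n2; rewrite (negPf n1) (negPf n2).
Qed.

Lemma sim_tperm s (i j : 'I_k) : (f <= i)%N = (f <= j)%N -> sim (s * tperm i j)%g s.
Proof.
wlog ij : i j / (i <= j)%N => [H|].
  by case: (leqP i j) => [/H // | /ltnW/H h E]; rewrite tpermC; apply: h.
move En : (j - i)%N => n; elim: n j s En ij => [|n IH] j s En ij E.
  have -> : i = j by apply: val_inj => /=; lia.
  by rewrite tperm1 mulg1; apply: sim_refl.
have j'k : (j.-1 < k)%N by rewrite (leq_ltn_trans (leq_pred j)).
pose j' := Ordinal j'k.
(* This transposition is [tgen k j], and j differs from f because i < j lie on the same side of
   f. *)
have step q : sim (q * tperm j' j)%g q.
  by rewrite -tgen_tperm /=; [apply: sim_tgen; have := ltn_ord j | ]; lia.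
case: (eqVneq i j') => [-> // | ne].
have ne' : i != j by apply/eqP => e; move: En; rewrite e; lia.
have -> : tperm i j = (tperm j' j * tperm i j' * tperm j' j)%g.
  rewrite -{1}(tpermV j' j) -mulgA -conjgE tpermJ tpermL.
  by rewrite tpermD // eq_sym.
rewrite !mulgA; apply: sim_trans (step _) _.
apply: sim_trans (IH j' _ _ _ _) (step _) => /=; lia.
Qed.

(** Induction on the support: composing [h] with the transposition of [h i] and [i], both in the
    same block, fixes [i] and keeps all fixed points of [h]. *)
Lemma sim_stab s (h : 'S_k) : (forall j, (f <= h j)%N = (f <= j)%N) -> sim (s * h)%g s.
Proof.
have [n] := ubnP #|[set j | h j != j]|; elim: n h => // n IH h /ltnSE-le_n hf.
case: (pickP [pred j | h j != j]) => [i /= hi | h1]; last first.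
  have -> : h = 1%g by apply/permP => j; rewrite perm1; apply/eqP; have := h1 j => /= /negbFE.
  by rewrite mulg1; apply: sim_refl.
pose h' := (h * tperm (h i) i)%g.
have -> : h = (h' * tperm (h i) i)%g by rewrite /h' -mulgA tperm2 mulg1.
rewrite mulgA; apply: sim_trans (sim_tperm _ _) (IH h' _ _); first exact: hf.
  apply: leq_trans le_n; apply: proper_card; apply/properP; split.
    apply/subsetP => j; rewrite !inE permM; apply: contraNN => /eqP hj; rewrite hj.
    rewrite tpermD //; last by apply: contraNneq hi => ->; rewrite hj.
    by apply: contraNneq hi => e; rewrite -(perm_inj (etrans hj (esym e))) hj.
  by exists i; rewrite !inE ?hi // permM tpermL eqxx.
move=> j; rewrite permM; case: tpermP => [e|e|_ _]; last exact: hf.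
  by rewrite -(perm_inj e).
by rewrite -[RHS]hf e hf.
Qed.

Lemma sim_act s t : act s = act t -> sim s t.
Proof.
move/act_eqP => E; rewrite -[s](mulKVg t); apply: sim_stab => j.
by rewrite permM E permKV.
Qed.

(** Permutations with the same word are congruent, so [x] may be reduced to one representative per
    word. *)
Lemma in_ideal_ev x : (forall v, ev v x = 0) -> in_ideal x.
Proof.
move=> x0.
pose rep s := odflt s [pick t | act t == act s].
have act_rep s : act (rep s) = act s by rewrite /rep; case: pickP => [t /eqP|].
have rep_act s t : act s = act t -> rep s = rep t.
  by rewrite /rep => <-; case: pickP => // /(_ s); rewrite eqxx.
(* The coefficient collected at a representative [q] is [ev (act q) x], which is zero. *)
have -> : x = \sum_s gascale (x s) (gdelta F s - gdelta F (rep s)).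
  apply/ffunP => q; rewrite sum_ffunE.
  under eq_bigr do rewrite !ffunE mulrBr.
  rewrite sumrB (bigD1 q) //= eqxx mulr1 big1 ?addr0; last first.
    by move=> s /negPf sq; rewrite eq_sym sq mulr0.
  rewrite [X in _ - X](_ : _ = 0) ?subr0 //.
  case: (pickP [pred s | rep s == q]) => [s /eqP sq | none]; last first.
    by rewrite big1 // => s _; have := none s => /= ; rewrite eq_sym => ->; rewrite mulr0.
  rewrite -[RHS](x0 (act q)); apply: eq_bigr => t _; congr (_ * (nat_of_bool _)%:R).
  apply/eqP/eqP => [->|tq]; first by rewrite act_rep.
  by rewrite -sq; apply: rep_act; rewrite tq -sq act_rep.
elim/big_ind: _ => [||s _]; [exact: in_ideal0 | exact: in_idealD |].
by apply: in_ideal_scale; apply: sim_act; rewrite act_rep.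
Qed.
End Evaluation.

(* In M^{(f,g)} = F S_k / (left ideal generated by t_i - 1, i <> f), m = class of 1,
   the identity  sum_mu t_mu m = sum_lam F(lam) s_lam m  says that the difference
   lies in that left ideal. *)
Theorem theorem5p12 (F : fieldType) (f g : nat) :
  exists a : nat -> GA F (f + g),
    \sum_(t : g.-tuple 'I_f.+1 | is_part t) gdelta F (t_lam f g (map val t))
    - \sum_(t : g.-tuple 'I_f.+1 | is_part t)
        gascale (Fpart (map val t))%:R (s_lam F f g (map val t))
    = \sum_(1 <= i < f + g | i != f) gamul (a i) (sgen F (f + g) i).
Proof.
apply: in_ideal_ev => v; rewrite ev_sub !ev_sum.
case: (eqVneq (size v) (f + g)%N) => szv; last first.
  have ev0 (x : GA F (f + g)) : ev f v x = 0.
    rewrite /ev big1 // => s _; case: eqP => [E | _]; last by rewrite mulr0.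
    by case/eqP: szv; rewrite -E size_act.
  by rewrite !big1 ?subr0.
rewrite (eq_bigr (fun t : g.-tuple 'I_f.+1 => (pword f (map val t) == v)%:R : F)); last first.
  move=> t; rewrite is_partE => pt; rewrite ev_delta.
  have sz : size (map val t) = g by rewrite size_map size_tuple.
  have := @act_word (f + g) f (map val t) 0; rewrite sz addn0 cats0 => -> //.
rewrite [X in _ - X](eq_bigr (fun t : g.-tuple 'I_f.+1 =>
   ((Fpart (map val t))%:Z * cup_vec (pword f (map val t)) v)%:~R : F)); last first.
  move=> t; rewrite is_partE => pt; rewrite ev_scale rmorphM /=; congr (_ * _).
  have sz : size (map val t) = g by rewrite size_map size_tuple.
  have := @ev_s_word F (f + g) f (map val t) 0; rewrite sz addn0 cats0 => -> //.
rewrite (sum_part_words (fun l => (pword f l == v)%:R : F)).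
rewrite (sum_part_words (fun l => ((Fpart l)%:Z * cup_vec (pword f l) v)%:~R : F)).
rewrite (eq_bigr (fun w => (w == v)%:R : F)); last by move=> w /eqP <-; rewrite wpartK.
rewrite [X in _ - X](eq_bigr (fun w => ((Fw w)%:Z * cup_vec w v)%:~R : F)); last first.
  by move=> w /eqP <-; rewrite wpartK.
case: (eqVneq (c0 v) f) => cv; last first.
  rewrite !big1 ?subrr // => w /eqP cw.
    case: (eqVneq (cup_vec w v) 0) => [->|/cup_coef_count /= E]; first by rewrite mulr0.
    by case/eqP: cv; rewrite -cw -E.
  by case: eqP => // E; rewrite -E cw eqxx in cv.
rewrite -big_filter (bigD1_seq v) ?filter_uniq ?uniq_words ?mem_filter ?mem_words //=; last first.
  by rewrite cv szv !eqxx.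
rewrite eqxx big1 ?addr0 => [|w /negPf->] //.
apply/eqP; rewrite subr_eq0 eq_sym; apply/eqP.
(* Words [w] with another number of 0's than [v] have zero coefficient, so the sum may be extended
   to all words. *)
rewrite -[RHS]/(1%:~R) -(sum_Fw_cup_vec szv) rmorph_sum /= [RHS](bigID (fun w => c0 w == f)) /=.
rewrite [X in _ = _ + X]big1 ?addr0 // => w cw.
case: (eqVneq (cup_vec w v) 0) => [->|/cup_coef_count /= E]; first by rewrite mulr0.
by case/eqP: cw; rewrite -E.
Qed.
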